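(* Let $\mathbf{k}$ be a field, $n\geq 2$, $A$ the free algebra on $n$ generators $e_1,\dots,e_n$ and $L$ the $n$th Leavitt algebra over $\mathbf{k}$. If $V$ is an irreducible (resp. indecomposable, nondegenerate and full) representation of $A$, then $\Pi(V)$ is an irreducible (resp. indecomposable) representation of $L$. Moreover, if $V,V'\in \mathrm{Rep}(A)$ are irreducible and nonzero (resp. indecomposable, nondegenerate and full), then $V\simeq V'$ if and only if $\Pi(V)\simeq \Pi(V')$.
   Context: **Algebras and modules.** $\mathbf{k}$ is a field, $n\ge 2$. $A$ is the free unital $\mathbf{k}$-algebra on $e_1,\dots,e_n$. $L$ is the Leavitt algebra: the unital $\mathbf{k}$-algebra generated by $e_1,\dots,e_n,e_1^*,\dots,e_n^*$ with relations $\sum_{i=1}^n e_ie_i^*=1$ and $e_j^*e_k=\delta_{j,k}$. Representations are right modules, written $v\cdot b$, assumed unital; $\mathrm{Rep}(A)$, $\mathrm{Rep}(L)$ are the categories of unital right modules (of arbitrary dimension). $\Lambda:\mathrm{Rep}(L)\to\mathrm{Rep}(A)$ is restriction along $\iota:A\to L$, $e_i\mapsto e_i$. A path (or word) $p$ is a finite product of the $e_i$; its length is $|p|$. A representation is irreducible if it contains no nonzero proper subrepresentation (with this convention the zero module is irreducible). It is indecomposable if it is not the direct sum of two nonzero submodules. A representation $(\pi,V)$ of $A$ is called nonzero if $\pi(e_i)\neq0$ for at least one generator $e_i$. **Trees.** A tree is a finite rooted planar tree in which each vertex has either $n$ ordered children or none (leaves). $I$ is the trivial tree with one vertex, the caret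 is the tree consisting of a root with $n$ leaves. $\mathcal T$ is the set of trees. Each leaf $\ell$ of a tree is identified with the word in the $e_i$'s describing the path from the root to $\ell$ ($e_i$ = go to the $i$th child). For $V\in\mathrm{Rep}(A)$ and a tree $t$ let $\Phi(t):V\to V^{\mathrm{Leaf}(t)}$, $v\mapsto (v\cdot \ell)_{\ell\in\mathrm{Leaf}(t)}$. **The functor $\Pi:\mathrm{Rep}(A)\to\mathrm{Rep}(L)$.** $\Pi(V)$ is the set of classes $[t,v]$ of pairs $(t,v)$ with $t\in\mathcal T$, $v:\mathrm{Leaf}(t)\to V$, for the equivalence relation generated by: $(t,v)\sim(t',v')$ whenever $t'$ is obtained from $t$ by gluing a tree $s_\ell$ at each leaf $\ell$ of $t$, and $v'$ is obtained by decorating the leaves of $s_\ell$ with $\Phi(s_\ell)(v_\ell)$. Equivalently, $\Pi(V)$ is the vector space direct limit of the spaces $V^{\mathrm{Leaf}(t)}$. The $L$-action: if $t$ is the caret with trees $t_1,\dots,t_n$ glued at its leaves and $v_j$ is the restriction of $v$ to the leaves of $t_j$, then $[t,v]\cdot e_j=[t_j,v_j]$; and $[s,w]\cdot e_j^*$ is the class of the caret with $(s,w)$ glued at its $j$th leaf and its other leaves decorated by $0$. On morphisms, $\Pi(\theta)[t,v_1,\dots,v_k]=[t,\theta(v_1),\dots,\theta(v_k)]$. The canonical map is $j_V:V\to\Pi(V)$, $v\mapsto[I,v]$, a morphism of $A$-modules $V\to\Lambda(\Pi(V))$. **Fullness, nondegeneracy.** A submodule $V_c\subset V$ is complete if for every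 $v\in V$ there is $k\geq1$ with $v\cdot p\in V_c$ for all paths $p$ with $|p|\ge k$. $V$ is full if it has no proper complete submodule. $V$ is nondegenerate if $j_V$ is injective. *)

(* Defs.v *)
From HB Require Import structures.
From Stdlib Require Import Relations.
From mathcomp Require Import all_boot all_order all_algebra.
From mathcomp Require Import finmap monalg boolp.

Set Implicit Arguments.
Unset Strict Implicit.
Unset Printing Implicit Defensive.

Import GRing.Theory.
Import Quotient.
Local Open Scope ring_scope.
Local Open Scope quotient_scope.

(* A right module over R is a left module over the converse ring R^c. *)
Definition ract (R : pzRingType) (V : lmodType R^c) (v : V) (b : R) : V :=
  (b : R^c) *: v.
Notation "v *:> b" := (ract v b) (at level 40, left associativity) : ring_scope.

Section RightModules.
Variables (R : pzRingType) (V : lmodType R^c).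
Implicit Types (v w : V) (a b : R).

Lemma ractDl v w b : (v + w) *:> b = v *:> b + w *:> b.
Proof. exact: scalerDr. Qed.
Lemma ractDr v a b : v *:> (a + b) = v *:> a + v *:> b.
Proof. exact: scalerDl. Qed.
Lemma ractA v a b : v *:> (a * b) = (v *:> a) *:> b.
Proof. by rewrite /ract scalerA. Qed.
Lemma ract1 v : v *:> 1 = v.
Proof. exact: scale1r. Qed.
Lemma ract0l b : (0 : V) *:> b = 0.
Proof. exact: scaler0. Qed.
Lemma ractNl v b : (- v) *:> b = - (v *:> b).
Proof. exact: scalerN. Qed.

(* By excluded middle and choice, {pred V} ranges over all subsets of V.
   The zero module is irreducible and indecomposable. *)
Definition irreducible_mod : Prop :=
  forall U : {pred V}, GRing.submod_closed U ->
    (forall v, v \in U -> v = 0) \/ (forall v, v \in U).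

Definition direct_sum (U W : {pred V}) : Prop :=
  (forall v, v \in U -> v \in W -> v = 0) /\
  (forall v, exists u w, [/\ u \in U, w \in W & v = u + w]).

Definition indecomposable_mod : Prop :=
  ~ exists U W : {pred V},
      [/\ GRing.submod_closed U, GRing.submod_closed W,
          exists2 u, u \in U & u <> 0, exists2 w, w \in W & w <> 0
        & direct_sum U W].

End RightModules.
Arguments irreducible_mod {R} V.
Arguments indecomposable_mod {R} V.

Definition isomorphic_mod (R : pzRingType) (V W : lmodType R^c) : Prop :=
  exists f : {linear V -> W}, bijective f.

Notation free_alg k X := {malg k[{fmonom X}]}.

Definition gen (k : fieldType) (X : choiceType) (x : X) : free_alg k X :=
  mkmalgU (fmu x) 1.
Arguments gen k {X} x.

Definition wpath (k : fieldType) (X : choiceType) (p : seq X) : free_alg k X :=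
  \prod_(x <- p) gen k x.
Arguments wpath k {X} p.

Lemma free_alg_scalerAr (k : fieldType) (X : choiceType) (c : k)
  (a b : free_alg k X) : c *: (a * b) = a * (c *: b).
Proof.
rewrite (malgMEw (fsubset_refl _) (msuppZ_le c b)) malgME scaler_sumr.
apply: eq_bigr => m _; rewrite scaler_sumr; apply: eq_bigr => m' _.
apply/malgP => w; rewrite mcoeffZ !mcoeffU mcoeffZ mulrnAr.
by rewrite mulrCA.
Qed.

Section FreeAlgebraAction.
Variables (k : fieldType) (X : choiceType) (P : lmodType k).
Variable op : X -> {linear P -> P}.
Local Notation F := (free_alg k X).
Implicit Types (a b : F) (p : P).

Definition word_act (m : seq X) (p : P) : P := foldl (fun q x => op x q) p m.

Definition free_act (a : F) (p : P) : P :=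
  \sum_(m <- msupp a) a@_m *: word_act m p.

Lemma word_act_lin m c p q :
  word_act m (c *: p + q) = c *: word_act m p + word_act m q.
Proof. by elim: m p q => [|x m IH] p q //=; rewrite linearP IH. Qed.

Lemma word_act0 m : word_act m 0 = 0.
Proof. by elim: m => [|x m IH] //=; rewrite linear0. Qed.

Lemma word_act_sum m (I : Type) (r : seq I) (f : I -> P) :
  word_act m (\sum_(i <- r) f i) = \sum_(i <- r) word_act m (f i).
Proof.
elim: r => [|i r IH]; rewrite ?(big_nil, big_cons) ?word_act0 //.
by have := word_act_lin m 1 (f i) (\sum_(j <- r) f j); rewrite !scale1r IH.
Qed.

Lemma word_actZ m c p : word_act m (c *: p) = c *: word_act m p.
Proof. by have := word_act_lin m c p 0; rewrite word_act0 !addr0. Qed.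

Lemma free_actEw (d : {fset {fmonom X}}) a p : (msupp a `<=` d)%fset ->
  free_act a p = \sum_(m <- d) a@_m *: word_act m p.
Proof.
move=> le; rewrite /free_act [LHS](big_fset_incl _ le) // => m _ /mcoeff_outdom ->.
by rewrite scale0r.
Qed.

Lemma free_actDl a b p : free_act (a + b) p = free_act a p + free_act b p.
Proof.
pose d := (msupp a `|` msupp b)%fset.
rewrite (@free_actEw d (a + b)) ?msuppD_le //.
rewrite (@free_actEw d a) ?fsubsetUl // (@free_actEw d b) ?fsubsetUr //.
by rewrite -big_split; apply: eq_bigr => m _; rewrite mcoeffD scalerDl.
Qed.

Lemma free_actZl c a p : free_act (c *: a) p = c *: free_act a p.
Proof.
rewrite (free_actEw _ (msuppZ_le _ _)) /free_act scaler_sumr.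
by apply: eq_bigr => m _; rewrite mcoeffZ scalerA.
Qed.

Lemma free_act0l p : free_act 0 p = 0.
Proof. by rewrite /free_act msupp0 big_seq_fset0. Qed.

Lemma free_act_lin a c p q :
  free_act a (c *: p + q) = c *: free_act a p + free_act a q.
Proof.
rewrite /free_act scaler_sumr -big_split; apply: eq_bigr => m _.
by rewrite word_act_lin scalerDr !scalerA mulrC.
Qed.

Lemma free_actDr a p q : free_act a (p + q) = free_act a p + free_act a q.
Proof. by have := free_act_lin a 1 p q; rewrite !scale1r. Qed.

Lemma free_actU c (m : {fmonom X}) p :
  free_act (mkmalgU m c) p = c *: word_act m p.
Proof. by rewrite (free_actEw _ msuppU_le) big_seq_fset1 mcoeffUU. Qed.

Lemma free_act1 p : free_act 1 p = p.
Proof. by rewrite free_actU scale1r fm1. Qed.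

Lemma free_act_gen x p : free_act (gen k x) p = op x p.
Proof. by rewrite free_actU scale1r fmU. Qed.

Lemma free_act_suml (I : Type) (r : seq I) (f : I -> F) p :
  free_act (\sum_(i <- r) f i) p = \sum_(i <- r) free_act (f i) p.
Proof.
by elim: r => [|i r IH]; rewrite ?(big_nil, big_cons) ?free_act0l ?free_actDl ?IH.
Qed.

Lemma free_actM a b p : free_act (a * b) p = free_act b (free_act a p).
Proof.
rewrite malgME free_act_suml.
under eq_bigr => m1 _.
  rewrite free_act_suml; under eq_bigr => m2 _.
    rewrite free_actU fmM /word_act foldl_cat -!/(word_act _ _).
    rewrite mulrC -scalerA -word_actZ; over.
  over.
rewrite exchange_big; apply: eq_bigr => m _ /=.
by rewrite -scaler_sumr -word_act_sum.
Qed.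

End FreeAlgebraAction.

Section Leavitt.
Variables (k : fieldType) (n : nat).

(* inl i stands for e_i and inr i for e_i^*. *)
Local Notation F := (free_alg k ('I_n + 'I_n)%type).
Local Notation ge i := (gen k (inl i) : F).
Local Notation gs i := (gen k (inr i) : F).

(* The two-sided ideal generated by the defining relations. *)
Inductive leavitt_ideal : F -> Prop :=
| LeavittSum : leavitt_ideal (\sum_(i < n) ge i * gs i - 1)
| LeavittDelta j l : leavitt_ideal (gs j * ge l - (j == l)%:R)
| LeavittZero : leavitt_ideal 0
| LeavittSub x y : leavitt_ideal x -> leavitt_ideal y -> leavitt_ideal (x - y)
| LeavittMulL a x : leavitt_ideal x -> leavitt_ideal (a * x)
| LeavittMulR a x : leavitt_ideal x -> leavitt_ideal (x * a).

Definition leavitt_pred : F -> bool := fun x => `[< leavitt_ideal x >].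

Fact leavitt_zmod_closed : zmod_closed leavitt_pred.
Proof.
split=> [|x y /asboolP Ix /asboolP Iy]; apply/asboolP.
  exact: LeavittZero.
exact: LeavittSub.
Qed.

HB.instance Definition _ := GRing.isZmodClosed.Build F leavitt_pred
  leavitt_zmod_closed.

Definition leavitt : Type := quot (GRing.ZmodClosed.clone F leavitt_pred _).
HB.instance Definition _ := GRing.Zmodule.on leavitt.
HB.instance Definition _ := EqQuotient.on leavitt.

Lemma leavitt_eqP (x y : F) :
  reflect (leavitt_ideal (x - y)) (x == y %[mod leavitt]).
Proof. by rewrite piE; exact: asboolP. Qed.

Definition leavitt_one : leavitt := \pi_leavitt 1.
Definition leavitt_mul (x y : leavitt) : leavitt :=
  \pi_leavitt (repr x * repr y).
Definition leavitt_scale (c : k) (x : leavitt) : leavitt :=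
  \pi_leavitt (c *: repr x).

Lemma leavitt_repr (x : F) : leavitt_ideal (repr (\pi_leavitt x) - x).
Proof. by apply/leavitt_eqP; rewrite reprK. Qed.

Lemma leavitt_ideal_add x y :
  leavitt_ideal x -> leavitt_ideal y -> leavitt_ideal (x + y).
Proof.
move=> Ix Iy; rewrite -[y]opprK -[- y]sub0r.
by apply: LeavittSub => //; apply: LeavittSub => //; exact: LeavittZero.
Qed.

Lemma pi_leavittD x y : \pi_leavitt (x + y) = \pi x + \pi y.
Proof. by rewrite !piE. Qed.

Lemma pi_leavittM x y : \pi_leavitt (x * y) = leavitt_mul (\pi x) (\pi y).
Proof.
apply/esym/eqP/leavitt_eqP; set x' := repr _; set y' := repr _.
have -> : x' * y' - x * y = (x' - x) * y' + x * (y' - y).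
  by rewrite mulrBl mulrBr addrA subrK.
apply: leavitt_ideal_add; first exact/LeavittMulR/leavitt_repr.
exact/LeavittMulL/leavitt_repr.
Qed.

Lemma pi_leavittZ c x : \pi_leavitt (c *: x) = leavitt_scale c (\pi x).
Proof.
apply/esym/eqP/leavitt_eqP; rewrite -scalerBr -mul_malgC.
by apply: LeavittMulL; exact: leavitt_repr.
Qed.

Lemma leavitt_mulA : associative leavitt_mul.
Proof.
elim/quotW=> x; elim/quotW=> y; elim/quotW=> z.
by rewrite -(pi_leavittM y) -(pi_leavittM x) -(pi_leavittM x y) -pi_leavittM mulrA.
Qed.

Lemma leavitt_mul1x : left_id leavitt_one leavitt_mul.
Proof. by elim/quotW=> x; rewrite -pi_leavittM mul1r. Qed.

Lemma leavitt_mulx1 : right_id leavitt_one leavitt_mul.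
Proof. by elim/quotW=> x; rewrite -pi_leavittM mulr1. Qed.

Lemma leavitt_mulDl : left_distributive leavitt_mul +%R.
Proof.
elim/quotW=> x; elim/quotW=> y; elim/quotW=> z.
by rewrite -pi_leavittD -(pi_leavittM x z) -(pi_leavittM y z) -pi_leavittM mulrDl pi_leavittD.
Qed.

Lemma leavitt_mulDr : right_distributive leavitt_mul +%R.
Proof.
elim/quotW=> x; elim/quotW=> y; elim/quotW=> z.
by rewrite -pi_leavittD -(pi_leavittM x y) -(pi_leavittM x z) -pi_leavittM mulrDr pi_leavittD.
Qed.

HB.instance Definition _ := GRing.Zmodule_isPzRing.Build leavitt
  leavitt_mulA leavitt_mul1x leavitt_mulx1 leavitt_mulDl leavitt_mulDr.

Lemma leavitt_scaleA c d x :
  leavitt_scale c (leavitt_scale d x) = leavitt_scale (c * d) x.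
Proof.
by elim/quotW: x => x; rewrite -(pi_leavittZ d) -!pi_leavittZ scalerA.
Qed.

Lemma leavitt_scale1 : left_id 1 leavitt_scale.
Proof. by elim/quotW=> x; rewrite -pi_leavittZ scale1r. Qed.

Lemma leavitt_scaleDr : right_distributive leavitt_scale +%R.
Proof.
move=> c; elim/quotW=> x; elim/quotW=> y.
by rewrite -pi_leavittD -(pi_leavittZ c x) -(pi_leavittZ c y) -pi_leavittZ scalerDr pi_leavittD.
Qed.

Lemma leavitt_scaleDl x : {morph leavitt_scale^~ x : c d / c + d}.
Proof.
move=> c d; elim/quotW: x => x.
by rewrite -(pi_leavittZ c) -(pi_leavittZ d) -pi_leavittZ -pi_leavittD scalerDl.
Qed.

HB.instance Definition _ := GRing.Zmodule_isLmodule.Build k leavitt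
  leavitt_scaleA leavitt_scale1 leavitt_scaleDr leavitt_scaleDl.

Lemma leavittM x y :
  \pi_leavitt (x * y) = (\pi_leavitt x : leavitt) * (\pi_leavitt y : leavitt).
Proof. exact: pi_leavittM. Qed.

Lemma leavittZ c x : \pi_leavitt (c *: x) = c *: (\pi_leavitt x : leavitt).
Proof. exact: pi_leavittZ. Qed.

Lemma leavitt_scaleAl (c : k) (x y : leavitt) : c *: (x * y) = (c *: x) * y.
Proof.
elim/quotW: x => x; elim/quotW: y => y.
rewrite -(leavittM x y) -leavittZ -(leavittZ c) -leavittM.
by rewrite scalerAl.
Qed.

Lemma leavitt_scaleAr (c : k) (x y : leavitt) : c *: (x * y) = x * (c *: y).
Proof.
elim/quotW: x => x; elim/quotW: y => y.
rewrite -(leavittM x y) -leavittZ -(leavittZ c) -leavittM.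
congr (\pi _); exact: free_alg_scalerAr.
Qed.

Definition leavitt_e (i : 'I_n) : leavitt := \pi_leavitt (ge i).
Definition leavitt_es (i : 'I_n) : leavitt := \pi_leavitt (gs i).

Lemma pi_leavitt_sum (I : Type) (r : seq I) (f : I -> F) :
  \pi_leavitt (\sum_(i <- r) f i) = \sum_(i <- r) (\pi_leavitt (f i) : leavitt).
Proof.
elim: r => [|i r IH]; first by rewrite !big_nil !piE.
by rewrite !big_cons pi_leavittD IH.
Qed.

Lemma leavitt_sum : \sum_(i < n) leavitt_e i * leavitt_es i = 1.
Proof.
under eq_bigr do rewrite -leavittM.
rewrite -pi_leavitt_sum; apply/eqP/leavitt_eqP; exact: LeavittSum.
Qed.

Lemma leavitt_delta j l : leavitt_es j * leavitt_e l = (j == l)%:R.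
Proof.
rewrite -leavittM; transitivity (\pi_leavitt ((j == l)%:R : F) : leavitt).
  by apply/eqP/leavitt_eqP; exact: LeavittDelta.
by case: (j == l); rewrite ?mulr1n ?mulr0n; [ | rewrite !piE].
Qed.

Section LeavittAction.
Variables (P : lmodType k) (op : 'I_n + 'I_n -> {linear P -> P}).
Hypothesis op_sum : forall p, \sum_(i < n) op (inr i) (op (inl i) p) = p.
Hypothesis op_delta : forall j l p, op (inl l) (op (inr j) p) = p *+ (j == l).

Lemma free_act_ideal (x : F) p : leavitt_ideal x -> free_act op x p = 0.
Proof.
move=> Ix; elim: Ix p => [|j l||y z _ IHy _ IHz|a y _ IH|a y _ IH] p.
- rewrite -scaleN1r free_actDl free_actZl free_act1 free_act_suml.
  under eq_bigr do rewrite free_actM !free_act_gen.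
  by rewrite op_sum scaleN1r subrr.
- rewrite -scaleN1r free_actDl free_actZl free_actM !free_act_gen op_delta.
  case: (j == l); first by rewrite mulr1n free_act1 scaleN1r subrr.
  by rewrite mulr0n free_act0l scaler0 addr0.
- exact: free_act0l.
- by rewrite -scaleN1r free_actDl free_actZl IHy IHz scaler0 addr0.
- by rewrite free_actM IH.
- rewrite free_actM IH; have := free_act_lin op a (-1) 0 0.
  by rewrite !scaler0 addr0 scaleN1r addNr.
Qed.

Definition leavitt_act (b : leavitt) (p : P) : P := free_act op (repr b) p.

Lemma leavitt_act_pi (x : F) p : leavitt_act (\pi_leavitt x) p = free_act op x p.
Proof.
have := free_act_ideal p (leavitt_repr x).
rewrite -scaleN1r free_actDl free_actZl scaleN1r => /eqP.
by rewrite subr_eq0 => /eqP.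
Qed.

Lemma leavitt_actM (a b : leavitt^c) p :
  leavitt_act a (leavitt_act b p) = leavitt_act (a * b) p.
Proof.
elim/quotW: a => a; elim/quotW: b => b.
have -> : (\pi_leavitt a : leavitt^c) * (\pi_leavitt b : leavitt^c)
  = \pi_leavitt (b * a) by rewrite leavittM.
by rewrite (leavitt_act_pi a) (leavitt_act_pi b) leavitt_act_pi free_actM.
Qed.

Lemma leavitt_act1 : left_id (1 : leavitt^c) leavitt_act.
Proof. by move=> p; rewrite (leavitt_act_pi 1) free_act1. Qed.

Lemma leavitt_actDr : right_distributive leavitt_act +%R.
Proof. by move=> a p q; exact: free_actDr. Qed.

Lemma leavitt_actDl p : {morph leavitt_act^~ p : a b / a + b}.
Proof.
elim/quotW=> a; elim/quotW=> b; rewrite -pi_leavittD.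
by rewrite (leavitt_act_pi a) (leavitt_act_pi b) leavitt_act_pi free_actDl.
Qed.

End LeavittAction.
End Leavitt.

Section Trees.
Variable n : nat.

Inductive tree := TTrivial | TNode of ('I_n -> tree).

Fixpoint leaf (t : tree) : Type :=
  match t with
  | TTrivial => unit
  | TNode f => {i : 'I_n & leaf (f i)}
  end.

Fixpoint leaf_word (t : tree) : leaf t -> seq 'I_n :=
  match t return leaf t -> seq 'I_n with
  | TTrivial => fun=> [::]
  | TNode f => fun l => tag l :: leaf_word (tagged l)
  end.

Fixpoint graft (t : tree) : (leaf t -> tree) -> tree :=
  match t return (leaf t -> tree) -> tree with
  | TTrivial => fun s => s tt
  | TNode f => fun s => TNode (fun i => @graft (f i) (fun l => s (Tagged (fun i => leaf (f i)) l)))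
  end.

(* A leaf of the grafted tree is a leaf l of t followed by a leaf of s l. *)
Fixpoint graft_leaf (t : tree) :
    forall s : leaf t -> tree, leaf (graft s) -> {l : leaf t & leaf (s l)} :=
  match t return
    forall s : leaf t -> tree, leaf (graft s) -> {l : leaf t & leaf (s l)} with
  | TTrivial => fun s m => @Tagged unit tt (fun l => leaf (s l)) m
  | TNode f => fun s m =>
      let: existT l m' := graft_leaf (tagged m) in
      @Tagged (leaf (TNode f)) (Tagged (fun i => leaf (f i)) l)
        (fun l => leaf (s l)) m'
  end.

Fixpoint height (t : tree) : nat :=
  match t with
  | TTrivial => 0
  | TNode f => (\max_(i < n) height (f i)).+1
  end.

Fixpoint full_tree (N : nat) : tree :=
  if N is N'.+1 then TNode (fun=> full_tree N') else TTrivial.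

End Trees.
Arguments TTrivial {n}.

Section DirectLimit.
Variables (k : fieldType) (n : nat).
Local Notation A := (free_alg k 'I_n).
Local Notation e i := (gen k i : A).
Variable V : lmodType A^c.

Definition decorated := {t : tree n & leaf t -> V}.
Definition Decorated (t : tree n) (v : leaf t -> V) : decorated :=
  existT (fun t => leaf t -> V) t v.

(* The algebra A acts on the right, so v *:> wpath k p applies the letters of p
   from left to right, i.e. from the root to the leaf. *)
Definition Phi (t : tree n) (v : V) : leaf t -> V :=
  fun l => v *:> wpath k (leaf_word l).

Inductive refines : decorated -> decorated -> Prop :=
| Refines (t : tree n) (v : leaf t -> V) (s : leaf t -> tree n) :
    refines (Decorated v)
      (Decorated (fun m : leaf (graft s) =>
         let: existT l m' := graft_leaf m in Phi (v l) m')).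

Definition decorated_eqv (x y : decorated) : Prop :=
  clos_refl_sym_trans decorated refines x y.

(* The caret with the decorated trees x i glued at its leaves. *)
Definition dnode (x : 'I_n -> decorated) : decorated :=
  Decorated (fun l : leaf (TNode (fun i => tag (x i))) => tagged (x (tag l)) (tagged l)).

Definition dleaf (v : V) : decorated := @Decorated TTrivial (fun=> v).

(* The decoration which x induces at the vertex w of any tree refining x
   that contains w; it is 0 if w is an interior vertex of x. *)
Fixpoint deco_at_rec (t : tree n) : (leaf t -> V) -> seq 'I_n -> V :=
  match t return (leaf t -> V) -> seq 'I_n -> V with
  | TTrivial => fun v w => v tt *:> wpath k w
  | TNode f => fun v w =>
      if w is i :: w' then @deco_at_rec (f i) (fun l => v (Tagged (fun i => leaf (f i)) l)) w' else 0
  end.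
Definition deco_at (x : decorated) (w : seq 'I_n) : V := deco_at_rec (tagged x) w.

Definition dheight (x : decorated) : nat := height (tag x).

Definition dfull (N : nat) (x : decorated) : decorated :=
  Decorated (fun l : leaf (full_tree n N) => deco_at x (leaf_word l)).

Lemma wpath_nil : wpath k [::] = 1 :> A.
Proof. exact: big_nil. Qed.
Lemma wpath_cons i w : wpath k (i :: w) = e i * wpath k w.
Proof. exact: big_cons. Qed.
Lemma wpath_cat w u : wpath k (w ++ u) = wpath k w * wpath k u :> A.
Proof. exact: big_cat. Qed.

Lemma dnodeE (f : 'I_n -> tree n) (v : leaf (TNode f) -> V) :
  @Decorated (TNode f) v = dnode (fun i => Decorated (fun l : leaf (f i) => v (Tagged (fun i => leaf (f i)) l))).
Proof. by rewrite /dnode /=; congr existT; apply: funext => -[i l]. Qed.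

Lemma decorated_ind (Q : decorated -> Prop) :
  (forall v, Q (dleaf v)) -> (forall x, (forall i, Q (x i)) -> Q (dnode x)) ->
  forall x, Q x.
Proof.
move=> Ql Qn [t v]; elim: t v => [|f IH] v; last first.
  by rewrite -/(Decorated v) dnodeE; apply: Qn => i; exact: IH.
by have := Ql (v tt); rewrite /dleaf; congr (Q _); congr existT; apply: funext => -[].
Qed.

Lemma refines_node (x y : 'I_n -> decorated) :
  (forall i, refines (x i) (y i)) -> refines (dnode x) (dnode y).
Proof.
move=> xy; have {}xy : forall i, exists s : leaf (tag (x i)) -> tree n,
    y i = Decorated (fun m : leaf (graft s) =>
         let: existT l m' := graft_leaf m in Phi (tagged (x i) l) m').
  by move=> i; case: (xy i) => t v s; exists s.
pose s i := projT1 (cid (xy i)).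
rewrite (funext (fun i => projT2 (cid (xy i)))) -/s.
pose s' (l : leaf (TNode (fun i => tag (x i)))) := s (tag l) (tagged l).
have := @Refines (TNode (fun i => tag (x i))) (tagged (dnode x)) s'.
congr refines; congr existT; apply: funext => -[i m] /=.
by rewrite /s' /=; case: graft_leaf.
Qed.

Lemma refines_full N x : (dheight x <= N)%N -> refines x (dfull N x).
Proof.
elim/decorated_ind: x N => [v|x IH] N.
  move=> _; exact: (@Refines TTrivial (fun=> v) (fun=> full_tree n N)).
case: N => [|N] //=; rewrite /dheight /= ltnS => le.
rewrite /dfull /= dnodeE; apply: refines_node => i; apply: IH.
exact: leq_trans (leq_bigmax i) le.
Qed.

Lemma deco_at_cat x w u : (dheight x <= size w)%N ->
  deco_at x (w ++ u) = deco_at x w *:> wpath k u.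
Proof.
elim/decorated_ind: x w => [v|x IH] [|i w] //= le.
- by rewrite /deco_at /= wpath_nil ract1.
- by rewrite /deco_at /= -cat_cons wpath_cat ractA.
by apply: IH; exact: leq_trans (leq_bigmax i) le.
Qed.

Lemma height_graft (t : tree n) (s : leaf t -> tree n) :
  (height t <= height (graft s))%N.
Proof.
elim: t s => [|f IH] s //=; rewrite ltnS; apply/bigmax_leqP => i _.
by apply: leq_trans (leq_bigmax i); exact: IH.
Qed.

Lemma deco_at_Phi (t : tree n) v w : (height t <= size w)%N ->
  deco_at (@Decorated t (Phi v)) w = v *:> wpath k w.
Proof.
elim: t v w => [|f IH] v [|i w] // le; rewrite /deco_at /=.
- by rewrite /Phi /= wpath_nil !ract1.
- by rewrite /Phi /= wpath_nil !ract1.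
rewrite wpath_cons ractA -(IH i (v *:> e i) w); last exact: leq_trans (leq_bigmax i) le.
rewrite /deco_at /=; congr deco_at_rec; apply: funext => l.
by rewrite /Phi /= wpath_cons ractA.
Qed.

Lemma refines_deco_at x y w : refines x y -> (dheight y <= size w)%N ->
  deco_at y w = deco_at x w.
Proof.
case=> t v s; rewrite /dheight /=; elim: t v s w => [|f IH] v s w.
  by move=> le; rewrite [LHS]deco_at_Phi.
case: w => [|i w] //= le; rewrite /deco_at /=.
rewrite -[RHS](IH i _ (fun l => s (Tagged (fun i => leaf (f i)) l))); last first.
  exact: leq_trans (leq_bigmax i) le.
rewrite /deco_at /=; congr deco_at_rec; apply: funext => l.
by case: graft_leaf.
Qed.

Lemma decorated_eqvP x y :
  decorated_eqv x y <->
  exists N, forall w, (N <= size w)%N -> deco_at x w = deco_at y w.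
Proof.
split=> [|[N eq_xy]].
  elim=> {x y} [x y xy|x|x y _ [N e]|x y z _ [N e] _ [M e']].
  - by exists (dheight y) => w le; rewrite (refines_deco_at xy).
  - by exists 0%N.
  - by exists N => w le; rewrite e.
  - exists (maxn N M) => w; rewrite geq_max => /andP[lN lM].
    by rewrite e // e'.
pose M := maxn N (maxn (dheight x) (dheight y)).
have size_full (K : nat) (l : leaf (full_tree n K)) : size (leaf_word l) = K.
  by elim: K l => [|K IH] //= l; rewrite IH.
have fullE : dfull M x = dfull M y.
  by congr existT; apply: funext => l; apply: eq_xy; rewrite size_full leq_maxl.
apply: (@rst_trans _ _ _ (dfull M x)).
  by apply/rst_step/refines_full; rewrite /M !leq_max leqnn orbT.
rewrite fullE; apply/rst_sym/rst_step/refines_full.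
by rewrite /M !leq_max leqnn !orbT.
Qed.

Definition dzero : decorated := dleaf 0.

(* Both summands are refined to a complete tree deep enough for both. *)
Definition dadd (x y : decorated) : decorated :=
  Decorated (fun l : leaf (full_tree n (maxn (dheight x) (dheight y))) =>
    deco_at x (leaf_word l) + deco_at y (leaf_word l)).

Definition dopp (x : decorated) : decorated :=
  Decorated (fun l : leaf (tag x) => - tagged x l).

Definition dscale (c : k) (x : decorated) : decorated :=
  Decorated (fun l : leaf (tag x) => tagged x l *:> (c *: 1 : A)).

(* The trivial tree decorated by v is first refined to the caret. *)
Definition dgen (j : 'I_n) (x : decorated) : decorated :=
  match x with
  | existT TTrivial v => dleaf (v tt *:> e j)
  | existT (TNode f) v =>
      Decorated (fun l : leaf (f j) => v (Tagged (fun i => leaf (f i)) l))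
  end.

Definition dstar (j : 'I_n) (x : decorated) : decorated :=
  dnode (fun i => if i == j then x else dzero).

Lemma deco_at_zero w : deco_at dzero w = 0.
Proof. exact: ract0l. Qed.

Lemma deco_at_full N (F : seq 'I_n -> V) w : (N <= size w)%N ->
  deco_at (Decorated (fun l : leaf (full_tree n N) => F (leaf_word l))) w
  = F (take N w) *:> wpath k (drop N w).
Proof.
elim: N F w => [|N IH] F [|i w] //= le.
by rewrite /deco_at /=; exact: (IH (fun u => F (i :: u))).
Qed.

Lemma deco_at_take N x w : (dheight x <= N)%N -> (N <= size w)%N ->
  deco_at x (take N w) *:> wpath k (drop N w) = deco_at x w.
Proof.
move=> le1 le2; rewrite -deco_at_cat ?cat_take_drop //.
by rewrite size_take_min (minn_idPl le2).
Qed.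

Lemma deco_at_add x y w : (maxn (dheight x) (dheight y) <= size w)%N ->
  deco_at (dadd x y) w = deco_at x w + deco_at y w.
Proof.
move=> le; rewrite (deco_at_full (fun u => deco_at x u + deco_at y u)) // ractDl.
by rewrite !deco_at_take ?leq_maxl ?leq_maxr.
Qed.

Lemma deco_at_opp x w : deco_at (dopp x) w = - deco_at x w.
Proof.
case: x => t v; rewrite /deco_at /=.
elim: t v w => [|f IH] v [|i w] //=; rewrite ?ractNl ?oppr0 //.
Qed.

Lemma ract_scalarC (c : k) (v : V) (b : A) :
  v *:> (c *: 1 : A) *:> b = v *:> b *:> (c *: 1 : A).
Proof. by rewrite -!ractA -scalerAl mul1r -free_alg_scalerAr mulr1. Qed.

Lemma deco_at_scale c x w :
  deco_at (dscale c x) w = deco_at x w *:> (c *: 1 : A).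
Proof.
case: x => t v; rewrite /deco_at /=.
elim: t v w => [|f IH] v [|i w] //=; rewrite ?ract0l ?ract_scalarC //.
Qed.

Lemma deco_at_gen j x w : (dheight x <= (size w).+1)%N ->
  deco_at (dgen j x) w = deco_at x (j :: w).
Proof.
case: x => -[|f] v //= le.
by rewrite /deco_at /= wpath_cons ractA.
Qed.

Lemma deco_at_star j x i w :
  deco_at (dstar j x) (i :: w) = if i == j then deco_at x w else 0.
Proof. by rewrite {1}/deco_at /= -/(deco_at _ _); case: eqP => // _; exact: deco_at_zero. Qed.

HB.instance Definition _ := gen_eqMixin decorated.
HB.instance Definition _ := gen_choiceMixin decorated.

Definition decorated_eqvb (x y : decorated) : bool := `[< decorated_eqv x y >].

Fact decorated_eqvb_equiv : equiv_class_of decorated_eqvb.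
Proof.
split=> [x|x y|y x z].
- by apply/asboolP; exact: rst_refl.
- by apply/asboolP/asboolP => h; exact: rst_sym.
- by move=> /asboolP xy /asboolP yz; apply/asboolP; exact: rst_trans yz.
Qed.

Canonical decorated_eqvb_rel := EquivRelPack decorated_eqvb_equiv.

Definition Pi_space : Type := {eq_quot decorated_eqvb}.
HB.instance Definition _ := Choice.on Pi_space.
HB.instance Definition _ := EqQuotient.on Pi_space.

Lemma Pi_eqP (x y : decorated) :
  reflect (exists N, forall w, (N <= size w)%N -> deco_at x w = deco_at y w)
    (x == y %[mod Pi_space]).
Proof.
rewrite piE; apply: (iffP (asboolP _)) => [/decorated_eqvP //|h].
exact/decorated_eqvP.
Qed.

Lemma Pi_repr x : exists N, forall w, (N <= size w)%N ->
  deco_at (repr (\pi_Pi_space x)) w = deco_at x w.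
Proof. by apply/Pi_eqP; rewrite reprK. Qed.

Definition Pi_zero : Pi_space := \pi_Pi_space dzero.
Definition Pi_add (p q : Pi_space) : Pi_space := \pi_Pi_space (dadd (repr p) (repr q)).
Definition Pi_opp (p : Pi_space) : Pi_space := \pi_Pi_space (dopp (repr p)).
Definition Pi_scale (c : k) (p : Pi_space) : Pi_space :=
  \pi_Pi_space (dscale c (repr p)).
Definition Pi_gen (j : 'I_n) (p : Pi_space) : Pi_space := \pi_Pi_space (dgen j (repr p)).
Definition Pi_star (j : 'I_n) (p : Pi_space) : Pi_space := \pi_Pi_space (dstar j (repr p)).

Lemma pi_Pi_add x y : Pi_add (\pi_Pi_space x) (\pi_Pi_space y) = \pi_Pi_space (dadd x y).
Proof.
rewrite /Pi_add; have [N hN] := Pi_repr x; have [M hM] := Pi_repr y.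
set x' := repr _ in hN *; set y' := repr _ in hM *; apply/eqP/Pi_eqP.
exists (maxn (maxn N M) (maxn (maxn (dheight x) (dheight y)) (maxn (dheight x') (dheight y')))).
move=> w; rewrite !geq_max -!andbA => /and5P[lN lM lx ly] /andP[lx' ly'].
by rewrite !deco_at_add ?geq_max ?lx ?ly ?lx' // hN // hM.
Qed.

Lemma pi_Pi_opp x : Pi_opp (\pi_Pi_space x) = \pi_Pi_space (dopp x).
Proof.
have [N hN] := Pi_repr x; apply/eqP/Pi_eqP; exists N => w le.
by rewrite !deco_at_opp hN.
Qed.

Lemma pi_Pi_scale c x : Pi_scale c (\pi_Pi_space x) = \pi_Pi_space (dscale c x).
Proof.
have [N hN] := Pi_repr x; apply/eqP/Pi_eqP; exists N => w le.
by rewrite !deco_at_scale hN.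
Qed.

Lemma pi_Pi_gen j x : Pi_gen j (\pi_Pi_space x) = \pi_Pi_space (dgen j x).
Proof.
rewrite /Pi_gen; have [N hN] := Pi_repr x.
set x' := repr _ in hN *; apply/eqP/Pi_eqP.
exists (maxn N (maxn (dheight x) (dheight x'))) => w.
rewrite !geq_max => /and3P[lN lx lx'].
by rewrite !deco_at_gen ?hN ?leqW.
Qed.

Lemma pi_Pi_star j x : Pi_star j (\pi_Pi_space x) = \pi_Pi_space (dstar j x).
Proof.
have [N hN] := Pi_repr x; apply/eqP/Pi_eqP; exists N.+1 => -[|i w] // le.
by rewrite !deco_at_star hN.
Qed.

Fact Pi_addA : associative Pi_add.
Proof.
elim/quotW=> x; elim/quotW=> y; elim/quotW=> z.
rewrite (pi_Pi_add y z) (pi_Pi_add x y) !pi_Pi_add; apply/eqP/Pi_eqP.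
exists (maxn (maxn (maxn (dheight x) (dheight y)) (dheight z))
  (maxn (dheight (dadd x y)) (dheight (dadd y z)))) => w.
rewrite !geq_max -!andbA => /and5P[lx ly lz lxy lyz].
by rewrite !deco_at_add ?geq_max ?lx ?ly ?lz ?lxy ?lyz // addrA.
Qed.

Fact Pi_addC : commutative Pi_add.
Proof.
elim/quotW=> x; elim/quotW=> y; rewrite !pi_Pi_add; apply/eqP/Pi_eqP.
exists (maxn (dheight x) (dheight y)) => w; rewrite geq_max => /andP[lx ly].
by rewrite !deco_at_add ?geq_max ?lx ?ly // addrC.
Qed.

Fact Pi_add0 : left_id Pi_zero Pi_add.
Proof.
elim/quotW=> x; rewrite (pi_Pi_add dzero); apply/eqP/Pi_eqP.
exists (dheight x) => w lx.
by rewrite !deco_at_add ?geq_max ?lx // deco_at_zero add0r.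
Qed.

Fact Pi_addN : left_inverse Pi_zero Pi_opp Pi_add.
Proof.
elim/quotW=> x; rewrite pi_Pi_opp pi_Pi_add; apply/eqP/Pi_eqP.
exists (maxn (dheight x) (dheight (dopp x))) => w; rewrite geq_max => /andP[lx ly].
by rewrite !deco_at_add ?geq_max ?lx ?ly // deco_at_opp addNr deco_at_zero.
Qed.

HB.instance Definition _ := GRing.isZmodule.Build Pi_space
  Pi_addA Pi_addC Pi_add0 Pi_addN.

Lemma Pi_addE x y : \pi_Pi_space x + \pi_Pi_space y = \pi_Pi_space (dadd x y).
Proof. exact: pi_Pi_add. Qed.

Fact Pi_scaleA c d p : Pi_scale c (Pi_scale d p) = Pi_scale (c * d) p.
Proof.
elim/quotW: p => x; rewrite (pi_Pi_scale d) !pi_Pi_scale; apply/eqP/Pi_eqP.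
exists 0%N => w _; rewrite !deco_at_scale -ractA; congr (_ *:> _).
by rewrite -scalerAl mul1r scalerA mulrC.
Qed.

Fact Pi_scale1 : left_id 1 Pi_scale.
Proof.
elim/quotW=> x; rewrite pi_Pi_scale; apply/eqP/Pi_eqP.
by exists 0%N => w _; rewrite deco_at_scale scale1r ract1.
Qed.

Fact Pi_scaleDr : right_distributive Pi_scale +%R.
Proof.
move=> c; elim/quotW=> x; elim/quotW=> y.
rewrite Pi_addE (pi_Pi_scale c x) (pi_Pi_scale c y) pi_Pi_scale Pi_addE.
apply/eqP/Pi_eqP.
exists (maxn (dheight x) (dheight y)) => w le.
by rewrite !(deco_at_add, deco_at_scale) // ractDl.
Qed.

Fact Pi_scaleDl p : {morph Pi_scale^~ p : c d / c + d}.
Proof.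
move=> c d; elim/quotW: p => x.
rewrite (pi_Pi_scale c x) (pi_Pi_scale d x) pi_Pi_scale Pi_addE.
apply/eqP/Pi_eqP; exists (dheight x) => w le.
by rewrite !(deco_at_add, deco_at_scale) ?geq_max ?le // -ractDr scalerDl.
Qed.

HB.instance Definition _ := GRing.Zmodule_isLmodule.Build k Pi_space
  Pi_scaleA Pi_scale1 Pi_scaleDr Pi_scaleDl.

Lemma Pi_scaleE c x : c *: \pi_Pi_space x = \pi_Pi_space (dscale c x).
Proof. exact: pi_Pi_scale. Qed.

Fact Pi_gen_linear j : linear (Pi_gen j).
Proof.
move=> c; elim/quotW=> x; elim/quotW=> y.
rewrite Pi_scaleE Pi_addE (pi_Pi_gen j x) (pi_Pi_gen j y) pi_Pi_gen Pi_scaleE Pi_addE.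
apply/eqP/Pi_eqP.
set N1 := dheight (dscale c (dgen j x)); set N2 := dheight (dgen j y).
exists (maxn (maxn (dheight x) (dheight y)) (maxn (maxn N1 N2)
  (maxn (dheight (dscale c x)) (dheight (dadd (dscale c x) y))))) => w.
rewrite !geq_max -!andbA => /and5P[lx ly l1 l2] /andP[l3 l4].
rewrite deco_at_gen ?leqW // !deco_at_add ?geq_max ?l1 ?l2 //=; last first.
  by rewrite !leqW.
by rewrite !deco_at_scale !deco_at_gen ?leqW.
Qed.

Fact Pi_star_linear j : linear (Pi_star j).
Proof.
move=> c; elim/quotW=> x; elim/quotW=> y.
rewrite Pi_scaleE Pi_addE (pi_Pi_star j x) (pi_Pi_star j y) pi_Pi_star Pi_scaleE Pi_addE.
apply/eqP/Pi_eqP.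
set N1 := dheight (dscale c (dstar j x)); set N2 := dheight (dstar j y).
exists (maxn (maxn N1 N2) (maxn (dheight (dscale c x)) (dheight y))).+1 => -[|i w] //=.
rewrite ltnS !geq_max -!andbA => /and4P[l1 l2 l3 l4].
rewrite deco_at_star !deco_at_add ?geq_max ?l1 ?l2 ?l3 //=; last first.
  by rewrite !leqW.
rewrite !deco_at_scale !deco_at_star; case: eqP => // _.
by rewrite ract0l addr0.
Qed.

HB.instance Definition _ j :=
  GRing.isLinear.Build k Pi_space Pi_space *:%R (Pi_gen j) (@Pi_gen_linear j).
HB.instance Definition _ j :=
  GRing.isLinear.Build k Pi_space Pi_space *:%R (Pi_star j) (@Pi_star_linear j).

Definition Pi_op (x : 'I_n + 'I_n) : {linear Pi_space -> Pi_space} :=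
  match x with inl j => Pi_gen j | inr j => Pi_star j end.

Lemma deco_at_pi_sum (I : Type) (r : seq I) (f : I -> decorated) :
  exists z, \sum_(i <- r) \pi_Pi_space (f i) = \pi_Pi_space z /\
  exists N, forall w, (N <= size w)%N -> deco_at z w = \sum_(i <- r) deco_at (f i) w.
Proof.
elim: r => [|i r [z [IH [N hN]]]].
  exists dzero; rewrite big_nil; split=> //; exists 0%N => w _.
  by rewrite big_nil deco_at_zero.
exists (dadd (f i) z); rewrite big_cons IH Pi_addE; split=> //.
exists (maxn N (maxn (dheight (f i)) (dheight z))) => w.
by rewrite geq_max => /andP[lN l]; rewrite deco_at_add // big_cons hN.
Qed.

Fact Pi_op_sum p : \sum_(i < n) Pi_op (inr i) (Pi_op (inl i) p) = p.
Proof.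
elim/quotW: p => x.
under eq_bigr do rewrite /= pi_Pi_gen pi_Pi_star.
have [z [-> [N hN]]] := deco_at_pi_sum (index_enum _) (fun i => dstar i (dgen i x)).
apply/eqP/Pi_eqP; exists (maxn N (dheight x).+1) => -[|i w].
  by rewrite geq_max andbF.
rewrite geq_max => /andP[lN l]; rewrite hN //.
under eq_bigr do rewrite deco_at_star eq_sym.
by rewrite -big_mkcond big_pred1_eq deco_at_gen // ltnW.
Qed.

Fact Pi_op_delta j l p : Pi_op (inl l) (Pi_op (inr j) p) = p *+ (j == l).
Proof.
elim/quotW: p => x; rewrite /= pi_Pi_star pi_Pi_gen.
transitivity (\pi_Pi_space (if j == l then x else dzero)); last by case: eqP.
apply/eqP/Pi_eqP; exists (dheight (dstar j x)) => w le.
rewrite deco_at_gen ?leqW // deco_at_star eq_sym.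
by case: eqP => // _; rewrite deco_at_zero.
Qed.

Definition Pi : Type := Pi_space.
HB.instance Definition _ := GRing.Zmodule.on Pi.

Definition Pi_lact (b : (leavitt k n)^c) (p : Pi) : Pi := leavitt_act Pi_op b p.

HB.instance Definition _ := GRing.Zmodule_isLmodule.Build (leavitt k n)^c Pi
  (leavitt_actM Pi_op_sum Pi_op_delta) (leavitt_act1 Pi_op_sum Pi_op_delta)
  (leavitt_actDr Pi_op) (leavitt_actDl Pi_op_sum Pi_op_delta).

Definition Pi_class (t : tree n) (v : leaf t -> V) : Pi :=
  \pi_Pi_space (Decorated v).

(* The canonical map from V to Pi V. *)
Definition Pi_unit (v : V) : Pi := @Pi_class TTrivial (fun=> v).

Lemma Pi_class_eqP (t t' : tree n) (v : leaf t -> V) (v' : leaf t' -> V) :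
  Pi_class v = Pi_class v' <-> decorated_eqv (Decorated v) (Decorated v').
Proof.
rewrite decorated_eqvP.
by split=> [/eqP/Pi_eqP //|h]; apply/eqP/Pi_eqP.
Qed.

Lemma Pi_classD (t : tree n) (v w : leaf t -> V) :
  Pi_class v + Pi_class w = Pi_class (fun l => v l + w l).
Proof.
have deco_atD u : deco_at (Decorated (fun l => v l + w l)) u
    = deco_at (Decorated v) u + deco_at (Decorated w) u.
  rewrite /deco_at /=; elim: t v w u => [|f IH] v w [|i u] //=;
  by rewrite ?ractDl ?addr0.
transitivity (\pi_Pi_space (dadd (Decorated v) (Decorated w)) : Pi).
  exact: Pi_addE.
apply/eqP/Pi_eqP; exists (height t) => u le.
by rewrite deco_at_add ?deco_atD // maxnn.
Qed.

Lemma Pi_class_scalar (t : tree n) (v : leaf t -> V) (c : k) :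
  Pi_class v *:> (c *: (1 : leavitt k n))
  = Pi_class (fun l => v l *:> (c *: 1 : A)).
Proof.
have -> : (c *: (1 : leavitt k n)) = \pi_(leavitt k n) (c *: 1).
  by rewrite leavittZ.
rewrite /ract /= [LHS](leavitt_act_pi Pi_op_sum Pi_op_delta).
by rewrite free_actZl free_act1 Pi_scaleE.
Qed.

Lemma Pi_class_e (f : 'I_n -> tree n) (v : leaf (TNode f) -> V) (j : 'I_n) :
  @Pi_class (TNode f) v *:> leavitt_e k j
  = Pi_class (fun l : leaf (f j) => v (Tagged (fun i => leaf (f i)) l)).
Proof.
rewrite /ract /= [LHS](leavitt_act_pi Pi_op_sum Pi_op_delta).
by rewrite free_act_gen /= pi_Pi_gen.
Qed.

Lemma Pi_class_es (s : tree n) (w : leaf s -> V) (j : 'I_n) :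
  Pi_class w *:> leavitt_es k j
  = Pi_class (tagged (dnode (fun i => if i == j then Decorated w else dleaf 0))).
Proof.
rewrite /ract /= [LHS](leavitt_act_pi Pi_op_sum Pi_op_delta).
by rewrite free_act_gen /= pi_Pi_star.
Qed.

Lemma Pi_unit_e (v : V) (i : 'I_n) :
  Pi_unit (v *:> e i) = Pi_unit v *:> leavitt_e k i.
Proof.
rewrite /ract [RHS](leavitt_act_pi Pi_op_sum Pi_op_delta).
by rewrite free_act_gen /= pi_Pi_gen.
Qed.

Definition nonzero_rep : Prop := exists (i : 'I_n) (v : V), v *:> e i <> 0.

Definition complete_sub (U : {pred V}) : Prop :=
  forall v, exists2 m, (1 <= m)%N &
    forall p : seq 'I_n, (m <= size p)%N -> v *:> wpath k p \in U.

Definition full_rep : Prop :=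
  forall U : {pred V}, GRing.submod_closed U -> complete_sub U ->
    forall v, v \in U.

Definition nondegenerate_rep : Prop := injective Pi_unit.

End DirectLimit.

(* Main.v *)
(* The image of V in Pi(V) absorbs long paths: for every p in Pi(V), p times any
   long enough path lies in j(V), while p is recovered from its products with
   the paths of a fixed length by applying the e_i^*. Hence an L-submodule U of
   Pi(V) is determined by the preimage j^-1(U); this settles irreducibility,
   and j^-1(U) + j^-1(W) is complete whenever Pi(V) = U + W, which settles
   indecomposability. An irreducible nonzero V is nondegenerate and full. If f
   is an isomorphism from Pi(V) to Pi(V'), the preimage of f(j(V)) under j' is
   complete, so fullness of V and V' gives f(j(V)) = j'(V'), and f restricts
   to an isomorphism from V to V'. *)
Require Import Defs.
From mathcomp Require Import all_boot all_order all_algebra.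
From mathcomp Require Import finmap monalg boolp.
From HB Require Import structures.

Set Implicit Arguments.
Unset Strict Implicit.
Unset Printing Implicit Defensive.

Import GRing.Theory.
Import Quotient.
Local Open Scope ring_scope.
Local Open Scope quotient_scope.

(** * Submodules and linear maps of right modules *)

Section Submodules.
Variables (R : pzRingType) (V : lmodType R^c) (U : {pred V}).
Hypothesis subU : GRing.submod_closed U.

Lemma submod0 : 0 \in U.
Proof. by case: subU. Qed.

Lemma submod_ract v b : v \in U -> v *:> b \in U.
Proof. by case: subU => U0 UL Uv; rewrite -[_ *:> _]addr0; exact: UL. Qed.

Lemma submodD v w : v \in U -> w \in U -> v + w \in U.
Proof. by case: subU => _ UL Uv Uw; rewrite -[v]scale1r; exact: UL. Qed.

Lemma submod_sum (I : Type) (r : seq I) (f : I -> V) :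
  (forall i, f i \in U) -> \sum_(i <- r) f i \in U.
Proof. by move=> Uf; apply: (big_ind (fun v => v \in U)) => //; [exact: submod0|exact: submodD]. Qed.

End Submodules.

Lemma submod_closedP (R : pzRingType) (V : lmodType R^c) (P : V -> Prop) :
  P 0 -> (forall v w, P v -> P w -> P (v + w)) ->
  (forall v b, P v -> P (v *:> b)) ->
  GRing.submod_closed [pred v | `[< P v >]].
Proof.
move=> P0 PD PM; split=> [|b v w]; rewrite !inE; first exact/asboolP.
by move=> /asboolP Pv /asboolP Pw; apply/asboolP/PD => //; exact: PM.
Qed.

Lemma ract_suml (R : pzRingType) (V : lmodType R^c) (v : V) (I : Type)
    (r : seq I) (f : I -> R) :
  v *:> \sum_(i <- r) f i = \sum_(i <- r) v *:> f i.
Proof. exact: (@scaler_suml R^c). Qed.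

Lemma ractBl (R : pzRingType) (V : lmodType R^c) (v w : V) (b : R) :
  (v - w) *:> b = v *:> b - w *:> b.
Proof. by rewrite ractDl ractNl. Qed.

Lemma linear_ract (R : pzRingType) (V W : lmodType R^c) (f : {linear V -> W})
    v (b : R) :
  f (v *:> b) = f v *:> b.
Proof. exact: linearZ. Qed.

Lemma linear_of_ract (R : pzRingType) (V W : lmodType R^c) (f : V -> W) :
  {morph f : v w / v + w} -> (forall b, {morph f : v / v *:> b}) ->
  exists g : {linear V -> W}, g =1 f.
Proof.
move=> fD fM; have lf : linear f by move=> b v w; rewrite fD; congr (_ + _); exact: fM.
pose hf := GRing.isLinear.Build R^c V W *:%R f lf.
by exists (HB.pack_for {linear V -> W} f hf).
Qed.

Lemma linear_inverse (R : pzRingType) (V W : lmodType R^c) (f : {linear V -> W}) :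
  bijective f -> exists g : {linear W -> V}, cancel f g /\ cancel g f.
Proof.
case=> g fK gK; have [||h hE] := @linear_of_ract _ _ _ g.
- by move=> v w; apply: (can_inj fK); rewrite linearD !gK.
- by move=> b v; apply: (can_inj fK); rewrite linear_ract !gK.
by exists h; split=> v; rewrite hE.
Qed.

(** * Induction on the free algebra, and maps commuting with its actions *)

Lemma free_alg_ind (k : fieldType) (X : choiceType) (P : free_alg k X -> Prop) :
  (forall c : k, P (c *: 1)) -> (forall x, P (gen k x)) ->
  (forall a b, P a -> P b -> P (a + b)) ->
  (forall a b, P a -> P b -> P (a * b)) -> forall a, P a.
Proof.
move=> Pc Pg PD PM a; rewrite [a]monalgE.
apply: big_ind => [||m _]; [by have := Pc 0; rewrite scale0r|exact: PD|].
have -> : << a@_m *g m >> = (a@_m *: 1) * << m >> :> free_alg k X.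
  rewrite -scalerAl mul1r; apply/malgP => w.
  by rewrite mcoeffZ [LHS]mcoeffU [in RHS]mcoeffU mulr_natr.
(* A monomial is now a scalar times a word, and the word is peeled off letter by letter. *)
apply: (PM) => //; case: m => s; elim: s => [|x s IH].
  have -> : FMonom [::] = mone :> {fmonom X} by apply: val_inj; rewrite /= fm1.
  by have := Pc 1; rewrite scale1r.
have -> : << FMonom (x :: s) >> = gen k x * << FMonom s >> :> free_alg k X.
  rewrite /gen (malgMEw msuppU_le msuppU_le) !big_seq_fset1 !mcoeffUU mulr1.
  by congr << _ *g _ >>; apply: val_inj; rewrite /= fmM fmU.
exact: PM.
Qed.

Lemma free_act_morph (k : fieldType) (X : choiceType) (P P' : lmodType k)
    (op : X -> {linear P -> P}) (op' : X -> {linear P' -> P'}) (h : P -> P') :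
  {morph h : p q / p + q} -> (forall c, {morph h : p / c *: p}) ->
  (forall x, {morph h : p / op x p >-> op' x p}) ->
  forall a, {morph h : p / free_act op a p >-> free_act op' a p}.
Proof.
move=> hD hZ hop a p; have h0 : h 0 = 0.
  by apply: (addrI (h 0)); rewrite -hD !addr0.
rewrite /free_act (big_morph h hD h0); apply: eq_bigr => m _; rewrite hZ.
by congr (_ *: _); elim: (m : seq X) p => [|x w IH] p //=; rewrite IH hop.
Qed.

(** * The canonical map [Pi_unit] and the action of paths on Pi(V) *)

Section Unit.
Variables (k : fieldType) (n : nat).
Local Notation A := (free_alg k 'I_n).
Local Notation L := (leavitt k n).

Definition leavitt_path (w : seq 'I_n) : L := \prod_(i <- w) leavitt_e k i.

Section OneModule.
Variable V : lmodType A^c.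
Implicit Types (v : V) (p : Pi V) (w : seq 'I_n).

Lemma Pi_unitD v v' : Pi_unit (v + v') = Pi_unit v + Pi_unit v'.
Proof. by rewrite [RHS]Pi_classD. Qed.

Lemma Pi_unit0 : Pi_unit (0 : V) = 0.
Proof. by apply: (addrI (Pi_unit (0 : V))); rewrite -Pi_unitD !addr0. Qed.

Lemma Pi_unit_path v w : Pi_unit (v *:> wpath k w) = Pi_unit v *:> leavitt_path w.
Proof.
elim: w v => [|i w IH] v; first by rewrite wpath_nil /leavitt_path big_nil !ract1.
by rewrite wpath_cons /leavitt_path big_cons !ractA IH Pi_unit_e.
Qed.

Lemma Pi_unit_eqP v v' : Pi_unit v = Pi_unit v' <->
  exists N, forall w, (N <= size w)%N -> v *:> wpath k w = v' *:> wpath k w.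
Proof. exact: iff_trans (Pi_class_eqP _ _) (decorated_eqvP _ _). Qed.

(** A path at least as long as the height of a representing tree runs down to a leaf, and its
    remainder acts in V on the decoration of that leaf. *)
Lemma Pi_path_unit p :
  exists N, forall w, (N <= size w)%N -> exists v, p *:> leavitt_path w = Pi_unit v.
Proof.
elim/quotW: p => -[t d]; exists (height t); rewrite -/(Decorated d) -/(Pi_class d).
elim: t d => [|f IH] d w.
  have -> : Pi_class d = Pi_unit (d tt) by rewrite /Pi_unit; congr Pi_class; apply: funext => -[].
  by exists (d tt *:> wpath k w); rewrite Pi_unit_path.
case: w => [|i w] //= le; rewrite /leavitt_path big_cons ractA Pi_class_e.
by apply: IH; exact: leq_trans (leq_bigmax i) le.
Qed.

(** Iterating the relation that the [e_i e_i^*] sum to 1 writes [p] as the sum of [(p w) w^*] over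
    the paths [w] of length [N]. *)
Lemma submod_path (U : {pred Pi V}) N p : GRing.submod_closed U ->
  (forall w, size w = N -> p *:> leavitt_path w \in U) -> p \in U.
Proof.
move=> subU; elim: N p => [|N IH] p Up.
  by have := Up [::] erefl; rewrite /leavitt_path big_nil ract1.
rewrite -[p]ract1 -leavitt_sum ract_suml; apply: submod_sum => // i.
rewrite ractA; apply: submod_ract => //; apply: IH => w sw.
by have := Up (i :: w); rewrite /= sw /leavitt_path big_cons ractA; apply.
Qed.

Lemma path_eq0 N p :
  (forall w, size w = N -> p *:> leavitt_path w = 0) -> p = 0.
Proof.
move=> p0; have sub0 : GRing.submod_closed [pred q : Pi V | `[< q = 0 >]].
  by apply: submod_closedP => [//|q r -> ->|q b ->]; rewrite ?addr0 ?ract0l.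
have := @submod_path _ N p sub0; rewrite inE => h; apply/asboolP/h => w sw.
by rewrite inE; apply/asboolP/p0.
Qed.

(** Long paths send an element of [U] into both [U] and the image of V, hence to 0, and [path_eq0]
    applies. *)
Lemma submod_eq0 (U : {pred Pi V}) : GRing.submod_closed U ->
  (forall v, Pi_unit v \in U -> Pi_unit v = 0) -> forall p, p \in U -> p = 0.
Proof.
move=> subU U0 p Up; have [N hN] := Pi_path_unit p.
apply: (@path_eq0 N) => w sw; have [|v e] := hN w; first by rewrite sw.
by rewrite e; apply: U0; rewrite -e; exact: submod_ract.
Qed.

End OneModule.

(* b is the image of a under the inclusion of A in L; it must not depend on V. *)
Lemma Pi_unit_restrict (a : A) :
  exists b : L, forall (V : lmodType A^c) (v : V), Pi_unit (v *:> a) = Pi_unit v *:> b.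
Proof.
elim/free_alg_ind: a => [c|i|a a' [b hb] [b' hb']|a a' [b hb] [b' hb']].
- by exists (c *: (1 : L)) => V v; rewrite [RHS]Pi_class_scalar.
- by exists (leavitt_e k i) => V v; exact: Pi_unit_e.
- by exists (b + b') => V v; rewrite !ractDr Pi_unitD hb hb'.
- by exists (b * b') => V v; rewrite !ractA hb' hb.
Qed.

Lemma submod_preim (V : lmodType A^c) (U : {pred Pi V}) : GRing.submod_closed U ->
  GRing.submod_closed [pred v | Pi_unit v \in U].
Proof.
move=> subU; split=> [|a v v']; rewrite !inE ?Pi_unit0; first exact: submod0.
move=> Uv Uv'; rewrite Pi_unitD submodD //.
have [b hb] := Pi_unit_restrict a.
have -> : Pi_unit (a *: v) = Pi_unit v *:> b by exact: hb.
exact: submod_ract.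
Qed.

(** * Irreducibility and indecomposability of Pi(V) *)

Theorem Pi_irreducible (V : lmodType A^c) :
  irreducible_mod V -> irreducible_mod (Pi V).
Proof.
move=> irr U subU; have [U0|UT] := irr _ (submod_preim subU); [left|right].
  by apply: submod_eq0 => // v Uv; rewrite (U0 v) ?Pi_unit0.
move=> p; have [N hN] := Pi_path_unit p.
apply: (@submod_path _ _ N) => // w sw; have [|v ->] := hN w; first by rewrite sw.
exact: UT.
Qed.

Theorem Pi_indecomposable (V : lmodType A^c) : indecomposable_mod V ->
  nondegenerate_rep V -> full_rep V -> indecomposable_mod (Pi V).
Proof.
move=> ind nd full [U [W [subU subW [u Uu u0] [w Ww w0] [UW0 UWT]]]].
pose U' : {pred V} := [pred v | Pi_unit v \in U]; pose W' : {pred V} := [pred v | Pi_unit v \in W].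
have subU' : GRing.submod_closed U' := submod_preim subU.
have subW' : GRing.submod_closed W' := submod_preim subW.
(* By [submod_eq0], a nonzero submodule of Pi(V) has a nonzero preimage in V. *)
have nz (X : {pred Pi V}) x : GRing.submod_closed X -> x \in X -> x <> 0 ->
    exists2 v, v \in [pred v : V | Pi_unit v \in X] & v <> 0.
  move=> subX Xx x0; apply: contrapT => none; apply/x0/(submod_eq0 subX) => // v Xv.
  have [->|/eqP v0] := eqVneq v 0; first exact: Pi_unit0.
  by case: none; exists v.
apply: ind; exists U', W'; split; [by []|by []|exact: nz Uu u0|exact: nz Ww w0|].
split=> [v|v].
  by rewrite !inE => Uv Wv; apply: nd; rewrite Pi_unit0; exact: UW0.
(* Fullness reduces V = U' + W' to the completeness of this sum. *)
pose sum : {pred V} := [pred v | `[< exists a b, [/\ a \in U', b \in W' & v = a + b] >]].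
suff /asboolP : v \in sum by [].
apply: full => [|{}v].
  apply: submod_closedP => [|_ _ [a [b [Ua Wb ->]]] [c [d [Uc Wd ->]]]|_ x [a [b [Ua Wb ->]]]].
  - by exists 0, 0; rewrite addr0; split=> //; exact: submod0.
  - by exists (a + c), (b + d); rewrite addrACA; split=> //; exact: submodD.
  - by exists (a *:> x), (b *:> x); rewrite ractDl; split=> //; exact: submod_ract.
have [p [q [Up Wq vE]]] := UWT (Pi_unit v).
have [N hN] := Pi_path_unit p; have [M hM] := Pi_path_unit q.
(* The successor only ensures that the bound is at least 1, as completeness asks. *)
exists (maxn N M).+1 => // x /ltnW; rewrite geq_max => /andP[lN lM].
have [a aE] := hN x lN; have [b bE] := hM x lM.
rewrite inE; apply/asboolP; exists a, b; rewrite !inE -aE -bE; split.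
- exact: submod_ract.
- exact: submod_ract.
by apply: nd; rewrite Pi_unit_path vE ractDl aE bE Pi_unitD.
Qed.

(** * Irreducible nonzero representations are nondegenerate and full *)

Lemma irreducible_path_eq0 (V : lmodType A^c) : irreducible_mod V -> nonzero_rep V ->
  forall (v : V) N, (forall w, (N <= size w)%N -> v *:> wpath k w = 0) -> v = 0.
Proof.
move=> irr [i0 [x0 nz]].
(* On [K] the algebra acts through constant terms, so [K] is a submodule; it is not V because some
   generator acts nontrivially, so it is 0. *)
pose K : {pred V} := [pred v | `[< forall i, v *:> gen k i = 0 >]].
have K_scalar (v : V) (a : A) : (forall i, v *:> gen k i = 0) ->
    exists c : k, v *:> a = v *:> (c *: 1).
  move=> v0; elim/free_alg_ind: a => [c|i|a b [c hc] [d hd]|a b [c hc] [d hd]].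
  - by exists c.
  - by exists 0; rewrite v0 scale0r; symmetry; exact: (@scale0r A^c).
  - by exists (c + d); rewrite ractDr hc hd -ractDr scalerDl.
  - exists (d * c); rewrite ractA hc ract_scalarC hd -ractA; congr (_ *:> _).
    by rewrite -scalerAl mul1r scalerA.
have subK : GRing.submod_closed K.
  apply: submod_closedP => [i|v w v0 w0 i|v a v0 i]; first exact: ract0l.
    by rewrite ractDl v0 w0 addr0.
  by have [c ->] := K_scalar v a v0; rewrite ract_scalarC v0 ract0l.
have ann0 (v : V) : (forall i, v *:> gen k i = 0) -> v = 0.
  move=> v0; have [K0|KT] := irr _ subK; first by apply: K0; rewrite inE; exact/asboolP.
  by have := KT x0; rewrite inE => /asboolP/(_ i0).
(* If paths of length at least [N.+1] kill [v], those of length at least [N] kill each [v e_i]; by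
   induction [v] lies in [K]. *)
move=> v N; elim: N v => [|N IH] v h.
  by have := h [::] isT; rewrite wpath_nil ract1.
apply: ann0 => i; apply: IH => w le.
by rewrite -ractA -wpath_cons h.
Qed.

Lemma irreducible_nondegenerate (V : lmodType A^c) :
  irreducible_mod V -> nonzero_rep V -> nondegenerate_rep V.
Proof.
move=> irr nz v v' /Pi_unit_eqP[N hN]; apply/eqP; rewrite -subr_eq0; apply/eqP.
apply: (irreducible_path_eq0 irr nz (N := N)) => w le.
by rewrite ractBl hN // subrr.
Qed.

(** Were the zero submodule complete, long paths would kill every vector, and V would be 0. *)
Lemma irreducible_full (V : lmodType A^c) :
  irreducible_mod V -> nonzero_rep V -> full_rep V.
Proof.
move=> irr nz U subU cU; have [U0|//] := irr U subU.
move=> v; have [N _ hN] := cU v.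
rewrite (irreducible_path_eq0 irr nz (v := v) (N := N)); first exact: submod0.
by move=> w le; apply: U0; exact: hN.
Qed.

(** * Recovering V from Pi(V) *)

Lemma full_unit_lift (V V' : lmodType A^c) (f : {linear Pi V -> Pi V'}) :
  bijective f -> full_rep V' ->
  forall v', exists v, f (Pi_unit v) = Pi_unit v'.
Proof.
move=> /linear_inverse[g [_ gK]] full v'.
pose U : {pred V'} := [pred v' | `[< exists v, f (Pi_unit v) = Pi_unit v' >]].
suff /asboolP : v' \in U by [].
apply: full => [|x].
  apply: submod_closedP => [|x y [v hv] [w hw]|x a [v hv]].
  - by exists 0; rewrite !Pi_unit0 linear0.
  - by exists (v + w); rewrite !Pi_unitD linearD hv hw.
  (* The same [b] serves V and V', so it can be moved through [f]. *)
  have [b hb] := Pi_unit_restrict a.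
  by exists (v *:> a); rewrite !hb linear_ract hv.
(* Completeness: long paths bring the pullback of [Pi_unit x] into the image of V. *)
have [N hN] := Pi_path_unit (g (Pi_unit x)).
exists N.+1 => // w /ltnW /hN[v hv]; rewrite inE; apply/asboolP; exists v.
by rewrite -hv linear_ract gK Pi_unit_path.
Qed.

Theorem Pi_isomorphic_inv (V V' : lmodType A^c) :
  nondegenerate_rep V -> full_rep V -> nondegenerate_rep V' -> full_rep V' ->
  isomorphic_mod (Pi V) (Pi V') -> isomorphic_mod V V'.
Proof.
move=> nd full nd' full' [f bf]; have [g [fK gK]] := linear_inverse bf.
have bg : bijective g by exists f.
have /choice[h' hh'] := full_unit_lift bf full'.
have /choice[h hh] := full_unit_lift bg full.
(* Thus [h] is [f] restricted to V; nondegeneracy will make it linear, with inverse [h']. *)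
have {}hh v : Pi_unit (h v) = f (Pi_unit v) by rewrite -[RHS](congr1 f (hh v)) gK.
have [||H HE] := @linear_of_ract _ _ _ h.
- by move=> v w; apply: nd'; rewrite Pi_unitD !hh Pi_unitD linearD.
- move=> a v; apply: nd'; have [b hb] := Pi_unit_restrict a.
  by rewrite hb !hh hb linear_ract.
exists H; exists h' => v; rewrite HE.
  by apply: nd; apply: (can_inj fK); rewrite hh' hh.
by apply: nd'; rewrite hh hh'.
Qed.

(** * Functoriality of Pi *)

Section Functor.
Variables (V V' : lmodType A^c) (theta : {linear V -> V'}).

Definition decorated_map (x : decorated V) : decorated V' :=
  Decorated (fun l : leaf (tag x) => theta (tagged x l)).

Definition Pi_map (p : Pi V) : Pi V' :=
  \pi_(Pi_space V') (decorated_map (repr (p : Pi_space V))).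

Lemma deco_at_map x w : deco_at (decorated_map x) w = theta (deco_at x w).
Proof.
case: x => t d; rewrite /deco_at /=.
by elim: t d w => [|f IH] d [|i w] //=; rewrite ?linear_ract ?linear0.
Qed.

(** Independence of the representative: equivalence is agreement of [deco_at] on long words, and
    [theta] commutes with [deco_at]. *)
Lemma Pi_map_pi x :
  Pi_map (\pi_(Pi_space V) x) = \pi_(Pi_space V') (decorated_map x).
Proof.
have [N hN] := Pi_repr x; apply/eqP/Pi_eqP; exists N => w le.
by rewrite !deco_at_map hN.
Qed.

Lemma Pi_mapD : {morph Pi_map : p q / p + q}.
Proof.
elim/quotW=> x; elim/quotW=> y.
rewrite [X in Pi_map X](Pi_addE x y) !Pi_map_pi [RHS]Pi_addE.
(* [decorated_map] keeps the tree, so both sums live on the same complete tree. *)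
case: x y => [t d] [t' d']; congr (\pi _); congr existT.
by apply: funext => l; rewrite /= linearD -!deco_at_map.
Qed.

(** A scalar [c] acts on decorations as [c *: 1] in A, with which [theta] commutes. *)
Lemma Pi_mapZ c (p : Pi_space V) :
  Pi_map (c *: p) = c *: (Pi_map p : Pi_space V').
Proof.
elim/quotW: p => -[t d]; rewrite Pi_scaleE !Pi_map_pi Pi_scaleE.
congr (\pi _); congr existT.
by apply: funext => l; rewrite /= linear_ract.
Qed.

Lemma Pi_map_gen j p : Pi_map (Pi_gen j p) = Pi_gen j (Pi_map p).
Proof.
elim/quotW: p => x; rewrite pi_Pi_gen !Pi_map_pi pi_Pi_gen; congr (\pi _).
case: x => -[|f] d //; congr existT.
by apply: funext => l; rewrite /= linear_ract.
Qed.

Lemma Pi_map_star j p : Pi_map (Pi_star j p) = Pi_star j (Pi_map p).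
Proof.
elim/quotW: p => x; rewrite pi_Pi_star !Pi_map_pi pi_Pi_star; congr (\pi _).
rewrite /dstar -[LHS]/(dnode (fun i => decorated_map _)); congr dnode.
apply: funext => i; case: eqP => // _; congr existT.
by apply: funext => l; rewrite /= linear0.
Qed.

(** A representative of [b] in the free algebra on the [e_i] and [e_i^*] acts as [b] does, so the
    generators suffice. *)
Lemma Pi_map_ract b : {morph Pi_map : p / p *:> b}.
Proof.
elim/quotW: b => a p.
rewrite /ract /= [X in Pi_map X](leavitt_act_pi (@Pi_op_sum _ _ V) (@Pi_op_delta _ _ V)).
rewrite [RHS](leavitt_act_pi (@Pi_op_sum _ _ V') (@Pi_op_delta _ _ V')).
apply: free_act_morph; [exact: Pi_mapD|exact: Pi_mapZ|].
by case=> i q; [exact: Pi_map_gen|exact: Pi_map_star].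
Qed.

End Functor.

Lemma Pi_map_can (V V' : lmodType A^c) (f : {linear V -> V'}) (g : {linear V' -> V}) :
  cancel f g -> cancel (Pi_map f) (Pi_map g).
Proof.
move=> fK; elim/quotW=> -[t d]; rewrite (Pi_map_pi f) Pi_map_pi; congr (\pi _).
by congr existT; apply: funext => l /=; rewrite fK.
Qed.

Theorem Pi_isomorphic (V V' : lmodType A^c) :
  isomorphic_mod V V' -> isomorphic_mod (Pi V) (Pi V').
Proof.
move=> [f /linear_inverse[g [fK gK]]].
have [F FE] := linear_of_ract (Pi_mapD f) (Pi_map_ract f).
by exists F; exists (Pi_map g) => p; rewrite FE; apply: Pi_map_can.
Qed.

End Unit.

Theorem theoremB (k : fieldType) (n : nat) (hn : (2 <= n)%N) :
  (forall V : lmodType (free_alg k 'I_n)^c,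
     irreducible_mod V -> irreducible_mod (Pi V)) /\
  (forall V : lmodType (free_alg k 'I_n)^c,
     indecomposable_mod V -> nondegenerate_rep V -> full_rep V -> indecomposable_mod (Pi V)) /\
  (forall V V' : lmodType (free_alg k 'I_n)^c,
     irreducible_mod V -> nonzero_rep V -> irreducible_mod V' -> nonzero_rep V' ->
     (isomorphic_mod V V' <-> isomorphic_mod (Pi V) (Pi V'))) /\
  (forall V V' : lmodType (free_alg k 'I_n)^c,
     indecomposable_mod V -> nondegenerate_rep V -> full_rep V ->
     indecomposable_mod V' -> nondegenerate_rep V' -> full_rep V' ->
     (isomorphic_mod V V' <-> isomorphic_mod (Pi V) (Pi V'))).
Proof.
split; [exact: Pi_irreducible|split; [exact: Pi_indecomposable|split]] => V V'.
  move=> irr nz irr' nz'; split; first exact: Pi_isomorphic.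
  by apply: Pi_isomorphic_inv; first [exact: irreducible_nondegenerate|exact: irreducible_full].
by move=> _ nd full _ nd' full'; split; [exact: Pi_isomorphic|exact: Pi_isomorphic_inv].
Qed.
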